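(* Let $\mathcal H\in\mathbb R^{n\times\cdots\times n}$ be an $(N+1)$st order tensor with mode-1 matricization $\mathbf H_{(1)}\in\mathbb R^{n\times n^N}$. For $i_1,\dots,i_N\in\{1,\dots,n\}$ let $\mathcal S_{\mathbf i}$ be the set of all permutations of $(i_1,\dots,i_N)$ and $\alpha_{\mathbf i}$ the number of elements of $\mathcal S_{\mathbf i}$. Let $\tilde{\mathcal H}$ be the $(N+1)$st order tensor of the same size whose mode-1 matricization $\tilde{\mathbf H}_{(1)}$ has as its $\omega$th column, $\omega=i_1+\sum_{l=2}^{N}(i_l-1)n^{l-1}$, $$\tilde{\mathbf H}_{(1)}(:,\omega)=\mathbf H_{(1)}\Big(\sum_{(j_1,\dots,j_N)\in\mathcal S_{\mathbf i}}\frac1{\alpha_{\mathbf i}}\big(\mathbf e_{j_1}\otimes\mathbf e_{j_2}\otimes\cdots\otimes\mathbf e_{j_N}\big)\Big).$$ Then: (a) $\mathbf H_{(1)}(\mathbf x\otimes\cdots\otimes\mathbf x)=\tilde{\mathbf H}_{(1)}(\mathbf x\otimes\cdots\otimes\mathbf x)$ for every $\mathbf x\in\mathbb R^n$ ($N$ Kronecker factors). (b) $\tilde{\mathbf H}_{(1)}\big(\mathbf q^{(1)}\otimes\cdots\otimes\mathbf q^{(N)}\big)=\tilde{\mathbf H}_{(1)}\big(\tilde{\mathbf q}^{(1)}\otimes\cdots\otimes\tilde{\mathbf q}^{(N)}\big)$ for all $\mathbf q^{(1)},\dots,\mathbf q^{(N)}\in\mathbb R^n$ and every permutation $(\tilde{\mathbf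 q}^{(1)},\dots,\tilde{\mathbf q}^{(N)})$ of $\mathbf q^{(1)},\dots,\mathbf q^{(N)}$. (c) All mode-$m$ matricizations of $\tilde{\mathcal H}$ for $m\ge2$ coincide: $\tilde{\mathbf H}_{(2)}=\tilde{\mathbf H}_{(3)}=\cdots=\tilde{\mathbf H}_{(N+1)}$.
   Context: $\mathbf e_j$ is the $j$th column of the $n\times n$ identity, $\otimes$ the Kronecker product. Permutations of $(i_1,\dots,i_N)$ are the distinct rearrangements of the tuple. For a $K$-way tensor $\boldsymbol{\mathcal X}\in\mathbb R^{n_1\times\cdots\times n_K}$, the mode-$m$ matricization $\boldsymbol X_{(m)}$ is defined by $\boldsymbol X_{(m)}(i_m,j)=\boldsymbol{\mathcal X}(i_1,\dots,i_K)$ with $j=1+\sum_{k=1,k\ne m}^{K}(i_k-1)J_k$ and $J_k=\prod_{z=1,z\ne m}^{k-1}n_z$. *)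

(* Defs.v *)
From mathcomp Require Import all_boot all_order all_algebra.
From mathcomp Require Import reals mxtens.

Set Implicit Arguments.
Unset Strict Implicit.
Unset Printing Implicit Defensive.

Import Order.TTheory GRing.Theory Num.Theory.
Local Open Scope ring_scope.

(* All indices (tensor entries, modes, rows, columns) are counted from 0, so
   every i - 1 of the 1-based formulas is just i here; mode 1 is ord0. *)

(* All K dimensions are equal to n. *)
Definition tensor (R : Type) (K n : nat) := {ffun K.-tuple 'I_n -> R}.

Section Indices.
Variables N n : nat.

(* The 0-based form of i_1 + \sum_(l = 2 .. N) (i_l - 1) n^(l-1). *)
Definition omega_nat (i : N.-tuple 'I_n) : nat :=
  (\sum_(l < N) tnth i l * n ^ l)%N.

(* The stride J_k = \prod_(z < k, z <> m) n_z, with every n_z equal to n. *)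
Definition stride (m k : 'I_N.+1) : nat :=
  (\prod_(z < N.+1 | (z < k) && (z != m)) n)%N.

(* The column of the mode-m matricization where the entry t is stored. *)
Definition mat_col_nat (m : 'I_N.+1) (t : N.+1.-tuple 'I_n) : nat :=
  (\sum_(k < N.+1 | k != m) tnth t k * stride m k)%N.

End Indices.

Lemma omega_nat_cons N n (a : 'I_n) (i : N.-tuple 'I_n) :
  omega_nat [tuple of a :: i] = (a + omega_nat i * n)%N.
Proof.
rewrite /omega_nat big_ord_recl tnth0 expn0 muln1; congr addn.
by rewrite big_distrl /=; apply: eq_bigr => l _; rewrite tnthS /bump /= expnSr mulnA.
Qed.

Lemma omega_nat_lt N n (i : N.-tuple 'I_n) : (omega_nat i < n ^ N)%N.
Proof.
elim: N i => [|N IH] i; first by rewrite /omega_nat big_ord0.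
case/tupleP: i => a i; rewrite omega_nat_cons expnSr.
apply: (@leq_trans ((omega_nat i).+1 * n)).
  by rewrite mulSn ltn_add2r ltn_ord.
by rewrite leq_mul2r IH orbT.
Qed.

Lemma omega_nat_inj N n : injective (@omega_nat N n).
Proof.
elim: N => [|N IH] i j; first by rewrite (tuple0 i) (tuple0 j).
case/tupleP: i => a i; case/tupleP: j => b j; rewrite !omega_nat_cons => e.
have n0 : (0 < n)%N by apply: leq_ltn_trans (ltn_ord a).
have eab : a = b.
  apply: val_inj; move: (congr1 (modn^~ n) e) => /=.
  by rewrite ![(_ + _ * n)%N]addnC !modnMDl !modn_small.
rewrite eab in e *; move/addnI/eqP: e; rewrite eqn_pmul2r // => /eqP /IH ->.
by [].
Qed.

Definition del_entry N n (m : 'I_N.+1) (t : N.+1.-tuple 'I_n) : N.-tuple 'I_n :=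
  [tuple tnth t (lift m l) | l < N].

Lemma big_lift (T : Type) (idx : T) (op : Monoid.com_law idx) N (m : 'I_N.+1)
    (P : pred 'I_N.+1) (F : 'I_N.+1 -> T) :
  \big[op/idx]_(k < N.+1 | P k && (k != m)) F k =
  \big[op/idx]_(l < N | P (lift m l)) F (lift m l).
Proof.
rewrite (reindex_omap (lift m) (unlift m)) /=.
  by apply: eq_bigl => l; rewrite liftK eqxx andbT eq_sym neq_lift andbT.
by move=> k; case: unliftP => [j ->|->]; rewrite ?eqxx ?andbF.
Qed.

Lemma stride_lift N n (m : 'I_N.+1) (l : 'I_N) :
  stride n m (lift m l) = (n ^ l)%N.
Proof.
rewrite /stride (big_lift _ _ (fun z : 'I_N.+1 => z < lift m l)%N).
have -> : (n ^ l = \prod_(z < l) n)%N by rewrite prod_nat_const card_ord.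
rewrite (big_ord_widen _ (fun=> n) (ltnW (ltn_ord l))).
by apply: eq_bigl => z /=; rewrite !ltnNge leq_bump2.
Qed.

Lemma mat_col_natE N n (m : 'I_N.+1) (t : N.+1.-tuple 'I_n) :
  mat_col_nat m t = omega_nat (del_entry m t).
Proof.
rewrite /mat_col_nat (big_lift _ _ xpredT) /omega_nat.
by apply: eq_bigr => l _; rewrite stride_lift tnth_mktuple.
Qed.

Lemma mat_col_nat_lt N n (m : 'I_N.+1) (t : N.+1.-tuple 'I_n) :
  (mat_col_nat m t < n ^ N)%N.
Proof. by rewrite mat_col_natE omega_nat_lt. Qed.

Definition omega N n (i : N.-tuple 'I_n) : 'I_(n ^ N) :=
  Ordinal (omega_nat_lt i).

Definition mat_col N n (m : 'I_N.+1) (t : N.+1.-tuple 'I_n) : 'I_(n ^ N) :=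
  Ordinal (mat_col_nat_lt m t).

(* The mode-m matricization, characterized by matricizationE below; each
   position (i, j) is the image of exactly one multi-index t, so the default
   value 0 is never used. *)
Definition matricization (R : nmodType) N n (m : 'I_N.+1)
    (X : tensor R N.+1 n) : 'M[R]_(n, n ^ N) :=
  \matrix_(i, j)
    if [pick t | (tnth t m == i) && (mat_col m t == j)] is Some t then X t else 0.

Lemma mat_col_inj N n (m : 'I_N.+1) (t u : N.+1.-tuple 'I_n) :
  tnth t m = tnth u m -> mat_col m t = mat_col m u -> t = u.
Proof.
move=> em /(congr1 val) /=; rewrite !mat_col_natE => /omega_nat_inj e.
apply: eq_from_tnth => k; case: (unliftP m k) => [l ->|-> //].
by move: (congr1 (fun d => tnth d l) e); rewrite !tnth_mktuple.
Qed.

Lemma matricizationE (R : nmodType) N n (m : 'I_N.+1) (X : tensor R N.+1 n) t :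
  matricization m X (tnth t m) (mat_col m t) = X t.
Proof.
rewrite mxE; case: pickP => [u /andP[/eqP em /eqP ec]|/(_ t)].
  by rewrite (mat_col_inj em ec).
by rewrite !eqxx.
Qed.

(* q_1 *t q_2 *t ... *t q_N, where *t is the Kronecker product of matrices; the
   casts only identify n * n ^ N with n ^ N.+1, and the empty product is 1. *)
Fixpoint kron (R : pzRingType) n N : N.-tuple 'cV[R]_n -> 'cV[R]_(n ^ N) :=
  match N with
  | 0 => fun=> 1%:M
  | N'.+1 => fun q =>
      castmx (esym (expnS n N'), mul1n 1)
             (thead q *t kron (behead_tuple q))
  end.

(* The set S_i of the distinct rearrangements of i; alpha_i is #|rearr i|. *)
Definition rearr N n (i : N.-tuple 'I_n) : {set N.-tuple 'I_n} :=
  [set j : N.-tuple 'I_n | perm_eq j i].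

Definition basis_vec (R : pzRingType) n (j : 'I_n) : 'cV[R]_n := col j 1%:M.
Arguments basis_vec R {n} j.

(* Ht is the tensor H-tilde attached to H. The column number omega i weighs the
   first entry of i least, while the single 1 of e_j1 *t ... *t e_jN is in the
   row that weighs j1 most; this mismatch has no effect, because rearr i is
   closed under reversal. *)
Definition is_symmetrization (R : fieldType) N n (H Ht : tensor R N.+1 n) : Prop :=
  forall i : N.-tuple 'I_n,
    col (omega i) (matricization ord0 Ht) =
    matricization ord0 H *m
      (\sum_(j in rearr i)
         (#|rearr i|%:R)^-1 *: kron [tuple basis_vec R (tnth j l) | l < N]).

Lemma mat_col_ord0 N n (a : 'I_n) (i : N.-tuple 'I_n) :
  mat_col ord0 [tuple of a :: i] = omega i.
Proof.
apply: val_inj; rewrite /= mat_col_natE; congr omega_nat.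
by apply: eq_from_tnth => l; rewrite tnth_mktuple tnthS.
Qed.

Lemma symmetrization_exists (R : fieldType) N n (H : tensor R N.+1 n) :
  exists Ht, is_symmetrization H Ht.
Proof.
exists [ffun t : N.+1.-tuple _ => (matricization ord0 H *m
  (\sum_(j in rearr (behead_tuple t)) (#|rearr (behead_tuple t)|%:R)^-1 *:
      kron [tuple basis_vec R (tnth j l) | l < N])) (thead t) 0].
move=> i; apply/colP => a; rewrite [LHS]mxE -(mat_col_ord0 a).
rewrite -[X in matricization _ _ X]/(thead [tuple of a :: i]) matricizationE.
rewrite ffunE theadE.
by have -> : behead_tuple [tuple of a :: i] = i by apply: val_inj.
Qed.

(* Main.v *)
Require Import Defs.
From mathcomp Require Import all_boot all_order all_algebra.
From mathcomp Require Import perm.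
From mathcomp Require Import reals mxtens.

Set Implicit Arguments.
Unset Strict Implicit.
Unset Printing Implicit Defensive.

Import GRing.Theory Num.Theory.
Local Open Scope ring_scope.

(** Write h_a for the function sending an N-tuple i to H(a, i), and define ht_a
    from Ht in the same way. Read entrywise, the hypothesis says that ht_a(i)
    is the average of h_a over the rearrangements of i ([symmetrizationE]), so
    ht_a takes equal values on rearrangements of one tuple
    ([symmetrization_tail_symmetric]). The product of a mode-1 matricization with a vector
    w is a sum over all tuples ([mulmx_matricization0]), and the entry of a
    Kronecker product at the tuple j is the product of the chosen entries of
    its factors ([kronE]).

    The weight of the tuple j in x * ... * x (Kronecker product) depends only
    on the multiset of its entries. Averaging h_a over rearrangements does not
    change its sum against such a weight: this is (a) ([sum_average_rearr]).

    Permuting the factors of a Kronecker product amounts to permuting the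
    positions in the summation tuple, to which ht_a is insensitive: this is
    (b) ([mulmx_kron_perm]).

    An entry of a mode-m matricization is the entry of Ht at the multi-index
    obtained by inserting the row number at position m in the tuple read off
    from the column number. When m is not the first mode the head of that
    multi-index comes from the column alone, and changing m only permutes the
    tail; hence (c) ([matricization_tail_symmetric]). *)

(** * Multi-indices as row and column numbers *)

Lemma omega_bij N n : bijective (@omega N n).
Proof.
apply: inj_card_bij; last by rewrite card_ord card_tuple card_ord.
by move=> i j /(congr1 val) /omega_nat_inj.
Qed.

Lemma omega_nat_rcons N n (i : N.-tuple 'I_n) (a : 'I_n) :
  omega_nat [tuple of rcons i a] = (omega_nat i + a * n ^ N)%N.
Proof.
rewrite /omega_nat big_ord_recr /=; congr (_ + _)%N.
  apply: eq_bigr => l _; rewrite !(tnth_nth a) /= nth_rcons size_tuple.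
  by rewrite ltn_ord.
by rewrite (tnth_nth a) /= nth_rcons size_tuple ltnn eqxx.
Qed.

Lemma rev_tupleK N (T : Type) : involutive (@rev_tuple N T).
Proof. by move=> t; apply: val_inj; rewrite /= revK. Qed.

(** A row number and a column number determine a multi-index by
    [mat_col_inj]; comparing cardinals, every pair of them occurs. *)
Lemma mat_index_surj N n (m : 'I_N.+1) (a : 'I_n) (c : 'I_(n ^ N)) :
  exists2 t : N.+1.-tuple 'I_n, tnth t m = a & mat_col m t = c.
Proof.
have [||f _ fK] := @inj_card_bij _ _
    (fun t : N.+1.-tuple 'I_n => (tnth t m, mat_col m t)).
- by move=> t u /pair_equal_spec[em ec]; apply: mat_col_inj em ec.
- by rewrite card_prod card_tuple !card_ord expnS.
by exists (f (a, c)); case: (fK (a, c)).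
Qed.

Lemma matricization0E (R : nmodType) N n (X : tensor R N.+1 n)
    (a : 'I_n) (i : N.-tuple 'I_n) :
  matricization ord0 X a (omega i) = X [tuple of a :: i].
Proof. by rewrite -(mat_col_ord0 a) -[a in LHS](tnth0 a i) matricizationE. Qed.

Lemma mulmx_matricization0 (R : pzRingType) N n (X : tensor R N.+1 n)
    (w : 'cV[R]_(n ^ N)) (a : 'I_n) :
  (matricization ord0 X *m w) a 0 =
  \sum_(j : N.-tuple 'I_n) X [tuple of a :: j] * w (omega j) 0.
Proof.
rewrite mxE (reindex (@omega N n)); last exact: onW_bij (omega_bij N n).
by apply: eq_bigr => j _; rewrite matricization0E.
Qed.

(** * Entries of Kronecker products *)

(** The reversal is there because [omega] weighs the first entry of a tuple
    least, whereas the first factor of a Kronecker product determines the most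
    significant digit of the row number. *)
Lemma kronE (R : comPzRingType) N n (q : N.-tuple 'cV[R]_n)
    (j : N.-tuple 'I_n) :
  kron q (omega (rev_tuple j)) 0 = \prod_(l < N) tnth q l (tnth j l) 0.
Proof.
elim: N q j => [|N IH] q j.
  by rewrite big_ord0 mxE (ord1 (omega (rev_tuple j))).
case/tupleP: q => v q; case/tupleP: j => a j.
rewrite big_ord_recl !tnth0 /= castmxE /= theadE.
have -> : behead_tuple [tuple of v :: q] = q by apply: val_inj.
have -> : cast_ord (esym (esym (expnS n N)))
            (omega (rev_tuple [tuple of a :: j]))
          = mxtens_index (a, omega (rev_tuple j)).
  apply: val_inj => /=; rewrite addnC -omega_nat_rcons.
  congr omega_nat; apply: val_inj => /=; exact: rev_cons.
have -> : cast_ord (esym (mul1n 1)) 0 = mxtens_index (0, 0) :> 'I_(1 * 1).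
  exact: val_inj.
rewrite tensmxE IH; congr (_ * _).
by apply: eq_bigr => l _; rewrite !tnthS.
Qed.

Lemma kron_basis_vec (R : comPzRingType) N n (i j : N.-tuple 'I_n) :
  kron [tuple basis_vec R (tnth i l) | l < N] (omega (rev_tuple j)) 0
  = (j == i)%:R.
Proof.
rewrite kronE.
under eq_bigr do rewrite tnth_mktuple !mxE.
have [->|neq_ji] := eqVneq j i; first by rewrite big1 // => l _; rewrite eqxx.
have [l neq_l|eq_ji] := pickP (fun l => tnth j l != tnth i l).
  by rewrite (bigD1 l) //= (negPf neq_l) mul0r.
case/eqP: neq_ji; apply: eq_from_tnth => l.
by apply/eqP; rewrite -[_ == _]negbK eq_ji.
Qed.

(** The product is taken over the entries of j in sequence form so that its
    invariance under rearranging j is an instance of [perm_big]. *)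
Lemma kron_nseq (R : comPzRingType) N n (x : 'cV[R]_n) (j : N.-tuple 'I_n) :
  kron (nseq_tuple N x) (omega j) 0 = \prod_(k <- j) x k 0.
Proof.
rewrite -[j in LHS]rev_tupleK kronE.
under [LHS]eq_bigr do rewrite tnth_nseq.
rewrite -(big_tuple _ _ (rev_tuple j) xpredT (fun k => x k 0)).
by apply: perm_big; rewrite perm_rev.
Qed.

(** * Averages over rearrangements *)

Lemma rearr_perm N n (i i' : N.-tuple 'I_n) :
  perm_eq i i' -> rearr i = rearr i'.
Proof. by move=> /permPr eq_i; apply/setP => j; rewrite !inE eq_i. Qed.

(** Each j contributes to the averages at all i in its own class, and there
    its coefficients 1 / #|rearr i| add up to 1; dividing by the size of a
    class is what requires characteristic zero. *)
Lemma sum_average_rearr (R : numFieldType) N n (h w : N.-tuple 'I_n -> R) :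
  (forall i j : N.-tuple 'I_n, perm_eq i j -> w i = w j) ->
  \sum_i (#|rearr i|%:R^-1 * \sum_(j in rearr i) h j) * w i =
  \sum_j h j * w j.
Proof.
move=> w_perm.
under eq_bigr do rewrite mulr_sumr mulr_suml.
rewrite (exchange_big_dep xpredT) //=; apply: eq_bigr => j _.
transitivity (\sum_(i in rearr j) #|rearr j|%:R^-1 * h j * w j).
  apply: eq_big => [i|i]; first by rewrite !inE perm_sym.
  by rewrite inE => ji; rewrite (rearr_perm ji) (w_perm _ _ ji).
rewrite sumr_const -[LHS]mulr_natl !mulrA mulfV ?mul1r // pnatr_eq0 -lt0n.
by apply/card_gt0P; exists j; rewrite inE.
Qed.

(** The coefficient vector in [is_symmetrization] has its nonzero entries at
    the reversals of the rearrangements of i; these are again exactly the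
    rearrangements of i, so no reversal remains. *)
Lemma symmetrizationE (R : fieldType) N n (H Ht : tensor R N.+1 n)
    (hHt : is_symmetrization H Ht) (a : 'I_n) (i : N.-tuple 'I_n) :
  Ht [tuple of a :: i] =
  #|rearr i|%:R^-1 * \sum_(j in rearr i) H [tuple of a :: j].
Proof.
have /colP/(_ a) := hHt i.
rewrite [LHS]mxE matricization0E mulmx_matricization0 => ->.
rewrite mulr_sumr [RHS]big_mkcond /=; apply: eq_bigr => j _.
have -> : (j \in rearr i) = (rev_tuple j \in rearr i) by rewrite !inE perm_rev.
rewrite summxE -[j in omega j]rev_tupleK.
under eq_bigr do rewrite mxE kron_basis_vec.
case: ifPn => [rj|/negPf rj].
  rewrite (bigD1 (rev_tuple j)) //= eqxx mulr1 big1 ?addr0 1?mulrC //.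
  by move=> k /andP[_ /negPf]; rewrite eq_sym => ->; rewrite mulr0.
rewrite big1 ?mulr0 // => k kS; case: eqP kS => [<-|_ _]; rewrite ?rj //.
by rewrite mulr0.
Qed.

Definition tail_symmetric (R : Type) N n (X : tensor R N.+1 n) : Prop :=
  forall (a : 'I_n) (i i' : N.-tuple 'I_n),
    perm_eq i i' -> X [tuple of a :: i] = X [tuple of a :: i'].

Lemma symmetrization_tail_symmetric (R : fieldType) N n
    (H Ht : tensor R N.+1 n) :
  is_symmetrization H Ht -> tail_symmetric Ht.
Proof.
move=> hHt a i i' /rearr_perm eq_S.
by rewrite !(symmetrizationE hHt) eq_S.
Qed.

(** * Tensors that are symmetric in their last modes *)

Definition tuple_perm (T : Type) N (s : 'S_N) (j : N.-tuple T) : N.-tuple T :=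
  [tuple tnth j (s l) | l < N].

Lemma tuple_permK (T : Type) N (s : 'S_N) :
  cancel (@tuple_perm T N s) (tuple_perm s^-1%g).
Proof.
by move=> j; apply: eq_from_tnth => l; rewrite !tnth_mktuple permKV.
Qed.

Lemma perm_tuple_perm (T : eqType) N (s : 'S_N) (j : N.-tuple T) :
  perm_eq (tuple_perm s j) j.
Proof. by apply/tuple_permP; exists s. Qed.

Lemma mulmx_kron_perm (R : comPzRingType) N n (X : tensor R N.+1 n)
    (q q' : N.-tuple 'cV[R]_n) :
  tail_symmetric X -> perm_eq q q' ->
  matricization ord0 X *m kron q = matricization ord0 X *m kron q'.
Proof.
move=> symX /tuple_permP[s /val_inj ->]; apply/colP => a.
have rev_inj := inv_inj (@rev_tupleK N 'I_n).
(* Reversing the summation tuple puts the Kronecker entries in the form of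
   kronE; it leaves the coefficients X unchanged by symmetry. *)
rewrite !mulmx_matricization0 (reindex_inj rev_inj) [RHS](reindex_inj rev_inj).
rewrite /= (reindex_inj (can_inj (@tuple_permK _ _ s))) /=.
apply: eq_bigr => j _; congr (_ * _).
  apply: symX; rewrite perm_rev perm_sym perm_rev perm_sym.
  exact: perm_tuple_perm.
rewrite !kronE [RHS](reindex_inj (@perm_inj _ s)).
by apply: eq_bigr => l _; rewrite !tnth_mktuple.
Qed.

Lemma perm_del_entry N n (m : 'I_N.+1) (t : N.+1.-tuple 'I_n) :
  perm_eq (tnth t m :: del_entry m t) t.
Proof.
apply/seq.permP => P; rewrite -!sum1_count [LHS]big_mkcond [RHS]big_mkcond big_cons.
rewrite (big_tuple _ _ (del_entry m t)) (big_tuple _ _ t).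
rewrite [RHS](@bigD1 _ _ _ _ m xpredT) //; congr addn.
rewrite [RHS](big_lift _ _ xpredT).
by apply: eq_bigr => l _; rewrite tnth_mktuple.
Qed.

Lemma thead_del_entry N n (m : 'I_N.+2) (t : N.+2.-tuple 'I_n) :
  m != ord0 -> thead (del_entry m t) = thead t.
Proof.
move=> m_neq0; rewrite /thead tnth_mktuple; congr tnth; apply: val_inj.
by rewrite /= /bump leqn0 (negPf (m_neq0 : val m != 0%N)).
Qed.

(** Let t and u be the multi-indices of one position in the two matricizations.
    Both are rearrangements of the row number followed by the tuple of the
    column number, and both have the head of that tuple as their head; so their
    tails are rearrangements of each other. *)
Lemma matricization_tail_symmetric (R : nmodType) N n (X : tensor R N.+1 n)
    (m m' : 'I_N.+1) :
  tail_symmetric X -> m != ord0 -> m' != ord0 ->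
  matricization m X = matricization m' X.
Proof.
case: N X m m' => [|N] X m m' symX m0 m'0; first by rewrite ord1 in m0.
apply/matrixP => a c.
have [t ta tc] := mat_index_surj m a c.
have [u ua uc] := mat_index_surj m' a c.
rewrite -{1}ta -{1}tc -ua -uc !matricizationE.
have eq_del : del_entry m t = del_entry m' u.
  have /(congr1 val) : mat_col m t = mat_col m' u by rewrite tc uc.
  by rewrite /= !mat_col_natE => /omega_nat_inj.
have : perm_eq t u.
  by rewrite -(permPl (perm_del_entry m t)) ta -ua eq_del perm_del_entry.
have : thead t = thead u.
  by rewrite -(thead_del_entry t m0) -(thead_del_entry u m'0) eq_del.
case/tupleP: t {ta tc eq_del} => b t; case/tupleP: u {ua uc} => b' u.
by rewrite !theadE => <-; rewrite perm_cons => /symX.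
Qed.

Theorem lemma1 (R : realType) (N n : nat) (hN : (0 < N)%N)
    (H Ht : tensor R N.+1 n) (hHt : is_symmetrization H Ht) :
  [/\ forall x : 'cV[R]_n,
        matricization ord0 H *m kron (nseq_tuple N x) =
        matricization ord0 Ht *m kron (nseq_tuple N x),
      forall q q' : N.-tuple 'cV[R]_n, perm_eq q q' ->
        matricization ord0 Ht *m kron q = matricization ord0 Ht *m kron q'
    & forall m m' : 'I_N.+1, m != ord0 -> m' != ord0 ->
        matricization m Ht = matricization m' Ht].
Proof.
have symHt := symmetrization_tail_symmetric hHt.
split.
- move=> x; apply/colP => a; rewrite !mulmx_matricization0.
  under [RHS]eq_bigr do rewrite (symmetrizationE hHt).
  rewrite (sum_average_rearr (fun j => H [tuple of a :: j])) //.
  by move=> i j ij; rewrite !kron_nseq; apply: perm_big.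
- by move=> q q'; exact: mulmx_kron_perm.
- by move=> m m'; exact: matricization_tail_symmetric.
Qed.
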